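(* Let $k=(k(n))_{n\ge 0}$ be a real sequence with $\sum_{n=0}^\infty |k(n)|<\infty$, and suppose that the solution $r$ of the resolvent equation $r(n+1)=\sum_{j=0}^{n}k(n-j)r(j)$, $n\ge 0$, $r(0)=1$, satisfies $\sum_{n=0}^\infty |r(n)|<\infty$. Let $f:\mathbb{R}\to\mathbb{R}$ be continuous with $\lim_{x\to\infty}f(x)/x=1$ and $\lim_{x\to-\infty}f(x)/x=1$. Let $H=(H(n))_{n\ge 0}$ be a real sequence, $\xi\in\mathbb{R}$, and let $x$ be the solution of $$x(n+1)=H(n+1)+\sum_{j=0}^{n}k(n-j)f(x(j)),\quad n\ge 0;\qquad x(0)=\xi.$$ If $(a(n))_{n\ge 0}$ is an increasing real sequence with $a(n)\to\infty$ as $n\to\infty$ such that $\Lambda_a|H|\in[0,\infty]$, then: (a) $\Lambda_a|x|=0$ if and only if $\Lambda_a|H|=0$; (b) $\Lambda_a|x|\in(0,\infty)$ if and only if $\Lambda_a|H|\in(0,\infty)$; (c) $\Lambda_a|x|=\infty$ if and only if $\Lambda_a|H|=\infty$.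
   Context: For a real sequence $y=(y(n))_{n\ge 0}$, $\Lambda_a|y|:=\limsup_{n\to\infty}|y(n)|/a(n)\in[0,\infty]$. The value $H(0)$ does not enter the equation for $x$. *)

(* Defs.v *)
From mathcomp Require Import all_boot all_order all_algebra.
From mathcomp Require Import all_classical all_reals all_analysis.

Set Implicit Arguments.
Unset Strict Implicit.
Unset Printing Implicit Defensive.

Import Order.TTheory GRing.Theory Num.Theory.
Import numFieldNormedType.Exports.

Local Open Scope classical_set_scope.
Local Open Scope ring_scope.

(* The quotient is formed in R, where dividing by 0 gives 0. When a tends to
   infinity this affects only finitely many indices, hence not the limsup. *)
Definition Lambda (R : realType) (a y : nat -> R) : \bar R :=
  limn_esup (fun n : nat => (`|y n| / a n)%:E).

Definition summable_seq (R : realType) (u : nat -> R) : Prop :=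
  cvgn [normed series u].

Definition is_resolvent (R : realType) (k r : nat -> R) : Prop :=
  r 0%N = 1 /\
  forall n : nat, r n.+1 = \sum_(j < n.+1) k (n - j)%N * r j.

Definition is_volterra_solution (R : realType) (k : nat -> R) (f : R -> R)
    (H : nat -> R) (xi : R) (x : nat -> R) : Prop :=
  x 0%N = xi /\
  forall n : nat, x n.+1 = H n.+1 + \sum_(j < n.+1) k (n - j)%N * f (x j).

(* Main.v *)
Require Import Defs.
From mathcomp Require Import all_boot all_order all_algebra.
From mathcomp Require Import all_classical all_reals all_analysis.
From mathcomp Require Import ring lra.

Import Order.TTheory GRing.Theory Num.Theory.
Import numFieldNormedType.Exports.

Local Open Scope classical_set_scope.
Local Open Scope ring_scope.

(** Everything follows from two linear inequalities: there are constants
    B, D > 0, depending only on k, r and f, such that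
      Lambda a x <= B * Lambda a H   and   Lambda a H <= D * Lambda a x
    in the extended reals. Being zero, or being infinite, then passes from
    either side to the other ([comparable_trichotomy]).

    Write f t = t + g t. The two limits of f t / t make g sublinear: for every
    e > 0 there is C with |g t| <= e |t| + C ([asymp_id_sublinear]). The
    equation for x is therefore the linear equation with kernel k and forcing
    h = H + k * g(x), and its solution is the convolution r * h
    ([variation_of_constants]). Let K and Q bound the l^1 norms of k and r, and
    let X be the maximum of |x| and M a bound for |H| on the indices 0, ..., n.
    Then X <= Q (|xi| + M + K (e X + C)), and taking e = 1 / (2 Q K) allows X to
    be absorbed on the left, so X <= A + B M ([solution_dominated]).
    Conversely |f t| <= 2 |t| + C, and reading the equation as a formula for H
    bounds H by the running maximum of x ([forcing_dominated]).

    Bounds by running maxima become bounds on Lambda because a is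
    nondecreasing and unbounded: if |z| is eventually at most c a, then up to a
    constant so is its running maximum, and a absorbs the constant
    ([Lambda_le_dominated]). *)

(** * Convolution and the resolvent *)

Definition conv {R : pzRingType} (u v : nat -> R) (n : nat) : R :=
  \sum_(j < n.+1) u (n - j)%N * v j.

Lemma convA {R : pzRingType} (u v w : nat -> R) (n : nat) :
  conv u (conv v w) n = conv (conv u v) w n.
Proof.
rewrite /conv.
under eq_bigr => j _.
  rewrite (big_ord_widen n.+1 (fun i => v (j - i)%N * w i)) ?ltn_ord //.
  rewrite big_distrr /=; over.
rewrite (exchange_big_dep xpredT) //=; apply: eq_bigr => i _.
rewrite big_distrl /=; under eq_bigr do rewrite mulrA.
rewrite -(big_geq_mkord i n.+1 xpredT
  (fun j => u (n - j)%N * v (j - i)%N * w i)).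
have i_le_n : (i <= n)%N by rewrite -ltnS.
rewrite -[X in \sum_(X <= _ < _) _]add0n big_addn subSn // big_mkord.
by apply: eq_bigr => l _; rewrite addnK -subnDA addnC.
Qed.

(** Associativity gives k * (r * h) = (k * r) * h, and k * r is r shifted by
    one; the last summand of (r * h)(n+1) is r(0) h(n+1) = h(n+1). *)
Lemma variation_of_constants {R : pzRingType} (k r h x : nat -> R) :
  r 0%N = 1 -> (forall n, r n.+1 = conv k r n) ->
  x 0%N = h 0%N -> (forall n, x n.+1 = h n.+1 + conv k x n) ->
  forall n, x n = conv r h n.
Proof.
move=> r0 rS x0 xS n; elim/ltn_ind: n => -[_|n IHn].
  by rewrite /conv big_ord_recl big_ord0 subn0 r0 mul1r addr0.
rewrite xS.
have -> : conv k x n = conv k (conv r h) n.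
  by apply: eq_bigr => j _; rewrite IHn.
rewrite convA addrC [RHS]/conv big_ord_recr /= subnn r0 mul1r; congr (_ + _).
by apply: eq_bigr => j _; rewrite subSn -?rS // -ltnS.
Qed.

(** The l^1 - l^oo case of Young's inequality. The bound on v is only asked up
    to n, so that it applies to running maxima; the constant is kept positive
    so that it can be divided by. *)
Lemma summable_conv_bound {R : realType} (u : nat -> R) :
  summable_seq u ->
  exists2 U, 0 < U & forall v n M, (forall j, (j <= n)%N -> `|v j| <= M) ->
    `|conv u v n| <= U * M.
Proof.
move=> cu; set S := limn [normed series u].
have le_S n : \sum_(j < n) `|u j| <= S.
  have nd : nondecreasing_seq [normed series u].
    by apply: nondecreasing_series => i _ _; exact: normr_ge0.
  rewrite -(big_mkord xpredT (fun j => `|u j|)).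
  exact: nondecreasing_cvgn_le.
have S0 : 0 <= S by have := le_S 0%N; rewrite big_ord0.
exists (S + 1) => [|v n M vM]; first by rewrite ltr_wpDl.
have M0 : 0 <= M by apply: le_trans (vM 0%N _).
apply: (@le_trans _ _ (S * M)); last by rewrite ler_wpM2r ?lerDl.
apply: le_trans (ler_norm_sum _ _ _) _.
apply: (@le_trans _ _ (\sum_(j < n.+1) `|u (n - j)%N| * M)).
  by apply: ler_sum => j _; rewrite normrM ler_wpM2l // vM // -ltnS.
rewrite -big_distrl /= ler_wpM2r // (reindex_inj rev_ord_inj) /=.
apply: le_trans (le_S n.+1); apply: ler_sum => j _.
by rewrite subSS subKn // -ltnS.
Qed.

(** * Sublinearity of f t - t *)

(** The limits handle |t| > T for a large T, with no constant; the constant C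
    is the maximum of |f t - t| over the compact interval [- T, T]. *)
Lemma asymp_id_sublinear {R : realType} (f : R -> R) (e : R) :
  continuous f -> f t / t @[t --> +oo] --> (1 : R) ->
  f t / t @[t --> -oo] --> (1 : R) -> 0 < e ->
  exists2 C, 0 <= C & forall t, `|f t - t| <= e * `|t| + C.
Proof.
move=> fc /cvgrPdist_lt fp /cvgrPdist_lt fn e0.
have far t : t != 0 -> `|1 - f t / t| < e -> `|f t - t| <= e * `|t|.
  move=> t0 /ltW; rewrite -(ler_pM2r (x := `|t|)) ?normr_gt0 //.
  by rewrite -normrM mulrBl mul1r divfK // distrC.
have [P [_ HP]] := fp e e0; have [N [_ HN]] := fn e e0.
pose T := Num.max 1 (Num.max P (- N)) + 1.
have T1 : 1 < T by rewrite /T ltr_pwDr // le_max lexx.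
have TP : P < T by rewrite /T ltr_pwDr // !le_max lexx !orbT.
have TN : - N < T by rewrite /T ltr_pwDr // !le_max lexx !orbT.
have gc : {within `[- T, T], continuous (fun t => `|f t - t|)}.
  apply: continuous_subspaceT => t; apply: cvg_norm.
  by apply: cvgB; [exact: fc | exact: cvg_id].
have [|c _ cmax] := EVT_max _ gc; first by lra.
exists (`|f c - c|) => // t.
have [tT|tT] := leP `|t| T.
  have : t \in `[- T, T]%R by rewrite in_itv /= -ler_norml.
  move=> /cmax; have : 0 <= e * `|t| by rewrite mulr_ge0 // ltW.
  lra.
apply: (@le_trans _ _ (e * `|t|)); last by rewrite lerDl.
have t0 : t != 0 by rewrite -normr_gt0; lra.
apply: far t0 _; move: tT; rewrite lter_normr => /orP[tT|tT].
- by apply: HP; lra.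
- by apply: HN; lra.
Qed.

(** * The limsup functional Lambda *)

(** The hypothesis on a is what makes the quotients eventually nonnegative:
    finitely many a n may be negative. *)
Lemma Lambda_ge0 {R : realType} (a y : nat -> R) :
  a n @[n --> \oo] --> +oo -> (0 <= Lambda a y)%E.
Proof.
move=> a_infty; rewrite /Lambda /limn_esup limf_esupE.
apply: le_ereal_inf_tmp => _ [V Voo <-].
have a0 : \forall n \near \oo, 0 < a n by move/cvgryPgt : a_infty; apply.
have [n [Vn an]] := filter_ex (filterI Voo a0).
apply: le_ereal_sup_tmp; exists (`|y n| / a n)%:E; first by exists n.
by rewrite lee_fin divr_ge0 // ltW.
Qed.

Lemma Lambda_le {R : realType} (a y : nat -> R) (c : R) :
  a n @[n --> \oo] --> +oo ->
  (\forall n \near \oo, `|y n| <= c * a n) -> (Lambda a y <= c%:E)%E.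
Proof.
move=> a_infty yc; apply: le_trans (ereal_inf_lbound _) _.
  exists [set n | `|y n| <= c * a n /\ 0 < a n]; last by reflexivity.
  by apply: filterI => //; move/cvgryPgt : a_infty; apply.
apply: ge_ereal_sup => _ [n [yn an] <-].
by rewrite lee_fin ler_pdivrMr.
Qed.

Lemma Lambda_lt {R : realType} (a y : nat -> R) (c : R) :
  a n @[n --> \oo] --> +oo ->
  (Lambda a y < c%:E)%E -> \forall n \near \oo, `|y n| <= c * a n.
Proof.
move=> a_infty /ereal_inf_lt[_ [V Voo <-] ltc].
have a0 : \forall n \near \oo, 0 < a n by move/cvgryPgt : a_infty; apply.
apply: filterS2 Voo a0 => n Vn an; rewrite -ler_pdivrMr // -lee_fin.
by apply: le_trans (ltW ltc); apply: ereal_sup_ubound; exists n.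
Qed.

(** The hypothesis on y is a bound by the running maximum of z, phrased through
    arbitrary upper bounds M. If |z j| <= c a(j) for j >= N, monotonicity of a
    makes C + c a(n) such a bound, where C sums |z j| over j < N; the constants
    A and B C disappear after division by a(n). *)
Lemma Lambda_le_dominated {R : realType} (a y z : nat -> R) (A B : R) :
  a n @[n --> \oo] --> +oo -> nondecreasing_seq a -> 0 < B ->
  (forall n M, (forall j, (j <= n)%N -> `|z j| <= M) -> `|y n| <= A + B * M) ->
  (Lambda a y <= B%:E * Lambda a z)%E.
Proof.
move=> a_infty a_nd B0 dom.
have step c e : (Lambda a z < c%:E)%E -> 0 < e ->
    (Lambda a y <= (B * c + e)%:E)%E.
  move=> ltc e0; have c0 : 0 < c.
    by rewrite -lte_fin; apply: le_lt_trans ltc; exact: Lambda_ge0.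
  have [N _ zN] := Lambda_lt _ _ _ a_infty ltc.
  pose C := \sum_(j < N) `|z j|.
  have a_large K : \forall n \near \oo, K < a n.
    by move/cvgryPgt : a_infty; apply.
  apply: Lambda_le => //.
  near=> n.
  have an : 0 < a n by near: n; exact: a_large.
  have zM j : (j <= n)%N -> `|z j| <= C + c * a n.
    move=> jn; have [jN|Nj] := ltnP j N.
      apply: (@le_trans _ _ C); last by rewrite lerDl mulr_ge0 // ltW.
      by rewrite /C (bigD1 (Ordinal jN)) //= lerDl sumr_ge0.
    apply: le_trans (zN j Nj) _; rewrite ler_wpDl ?sumr_ge0 //.
    by rewrite ler_wpM2l ?a_nd // ltW.
  apply: le_trans (dom _ _ zM) _.
  have : A + B * C <= e * a n.
    rewrite -ler_pdivrMl //; apply: ltW.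
    by near: n; exact: a_large.
  lra.
have: (0 <= Lambda a z)%E := Lambda_ge0 a z a_infty.
case Ez : (Lambda a z) => [l| |] // _; last by rewrite gt0_muley ?lte_fin ?leey.
apply/lee_addgt0Pr => e e0.
have -> : (B%:E * l%:E + e%:E)%E = (B * (l + e / 2 / B) + e / 2)%:E.
  by rewrite -EFinM -EFinD; congr (_%:E); field; rewrite gt_eqF.
apply: step; last by lra.
by rewrite Ez lte_fin ltrDl !divr_gt0.
Unshelve. all: by end_near. Qed.

(** * The solution and the forcing dominate each other *)

Lemma solution_dominated {R : realType} (k r : nat -> R) (f : R -> R)
    (H : nat -> R) (xi : R) (x : nat -> R) :
  summable_seq k -> is_resolvent k r -> summable_seq r ->
  (forall e, 0 < e -> exists2 C, 0 <= C &
     forall t, `|f t - t| <= e * `|t| + C) ->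
  is_volterra_solution k f H xi x ->
  exists A B, 0 < B /\ forall n M,
    (forall j, (j <= n)%N -> `|H j| <= M) -> `|x n| <= A + B * M.
Proof.
move=> /summable_conv_bound[K K0 leK] [r0 rS] /summable_conv_bound[Q Q0 leQ].
move=> f_sub [x0 xS].
(* This size of e turns the feedback term Q K e X into X / 2. *)
have e0 : 0 < (2 * (Q * K))^-1 by rewrite invr_gt0 !mulr_gt0.
have [C C0 leC] := f_sub _ e0; set e := (2 * _)^-1 in e0 leC.
pose g j := f (x j) - x j.
pose h n := if n is m.+1 then H m.+1 + conv k g m else xi.
have xE : forall n, x n = conv r h n.
  apply: (variation_of_constants k) => // n; rewrite xS /= -addrA.
  congr (_ + _); rewrite /conv -big_split /=.
  by apply: eq_bigr => j _; rewrite -mulrDr subrK.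
exists (2 * Q * (`|xi| + K * C)), (2 * Q); split=> [|n M HM].
  by rewrite mulr_gt0.
have M0 : 0 <= M by apply: le_trans (HM 0%N _).
(* X is attained at an index i <= n, so a bound on |x i| is a bound on X. *)
have [i _ imax] := @arg_maxP _ _ 'I_n.+1 ord0 xpredT (fun i => `|x i|) isT.
set X := `|x i|.
have xX j : (j <= n)%N -> `|x j| <= X.
  by rewrite -ltnS => jn; exact: (imax (Ordinal jn)).
have gX j : (j <= n)%N -> `|g j| <= e * X + C.
  move=> jn; apply: le_trans (leC _) _.
  by rewrite lerD2r ler_wpM2l ?xX // ltW.
have hX j : (j <= n)%N -> `|h j| <= `|xi| + M + K * (e * X + C).
  have gK m : (m <= n)%N -> `|conv k g m| <= K * (e * X + C).
    by move=> mn; apply: leK => l lm; apply: gX; exact: leq_trans lm mn.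
  case: j => [_|m mn] /=.
    rewrite -addrA lerDl addr_ge0 //.
    by apply: le_trans (gK 0%N _).
  apply: le_trans (ler_normD _ _) _; apply: lerD; last exact/gK/ltnW.
  by apply: le_trans (HM _ mn) _; rewrite lerDr.
have : X <= Q * (`|xi| + M + K * (e * X + C)).
  rewrite {1}/X xE; apply: leQ => j ji; apply: hX.
  by apply: leq_trans ji _; rewrite -ltnS.
have -> : Q * (`|xi| + M + K * (e * X + C)) =
    Q * (`|xi| + K * C) + Q * M + X / 2.
  by rewrite /e; field; rewrite !gt_eqF.
have := xX _ (leqnn n); lra.
Qed.

Lemma forcing_dominated {R : realType} (k : nat -> R) (f : R -> R)
    (H : nat -> R) (xi : R) (x : nat -> R) :
  summable_seq k ->
  (exists2 C, 0 <= C & forall t, `|f t - t| <= 1 * `|t| + C) ->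
  is_volterra_solution k f H xi x ->
  exists A B, 0 < B /\ forall n M,
    (forall j, (j <= n)%N -> `|x j| <= M) -> `|H n| <= A + B * M.
Proof.
move=> /summable_conv_bound[K K0 leK] [C C0 leC] [x0 xS].
(* The equation says nothing about H 0, so |H 0| is put into the constant. *)
exists (`|H 0%N| + K * C), (1 + 2 * K); split=> [|n M xM].
  by rewrite ltr_pwDl // mulr_ge0 // ltW.
have M0 : 0 <= M by apply: le_trans (xM 0%N _).
have KC0 : 0 <= K * C by rewrite mulr_ge0 // ltW.
have KM0 : 0 <= K * M by rewrite mulr_ge0 // ltW.
case: n xM => [|n] xM; first by lra.
have fM j : (j <= n)%N -> `|f (x j)| <= 2 * M + C.
  move=> jn; have := leC (x j); have := xM _ (leqW jn).
  have := ler_normD (f (x j) - x j) (x j); rewrite subrK; lra.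
have := leK (f \o x) n _ fM.
have -> : H n.+1 = x n.+1 - conv k (f \o x) n by rewrite xS addrK.
have := ler_normB (x n.+1) (conv k (f \o x) n).
have := xM _ (leqnn n.+1); have := normr_ge0 (H 0%N); lra.
Qed.

(** * The equivalences *)

Lemma comparable_trichotomy {R : realType} (X Y : \bar R) (B D : R) :
  (0 <= X)%E -> (0 <= Y)%E -> 0 < B -> 0 < D ->
  (X <= B%:E * Y)%E -> (Y <= D%:E * X)%E ->
  [/\ X = 0%E <-> Y = 0%E, (0 < X < +oo)%E <-> (0 < Y < +oo)%E
    & X = +oo%E <-> Y = +oo%E].
Proof.
move=> X0 Y0 B0 D0 XY YX.
have zero : X = 0%E <-> Y = 0%E.
  split=> E0; [move: YX|move: XY]; rewrite E0 mule0 => le0;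
  by apply/eqP; rewrite eq_le le0.
have infty : X = +oo%E <-> Y = +oo%E.
  split=> Eoo; [move: XY X0|move: YX Y0]; rewrite Eoo.
    by case: Y Y0 {YX zero} => [y| |].
  by case: X X0 {XY zero} => [y| |].
split=> //.
have ne (Z : \bar R) : (0 <= Z)%E -> (0 < Z < +oo)%E <-> Z <> 0%E /\ Z <> +oo%E.
  move=> Z0; rewrite lt0e Z0 andbT ltey; split.
    by move=> /andP[/eqP ? /eqP ?].
  by move=> [/eqP -> /eqP ->].
rewrite !ne //; tauto.
Qed.

Theorem theorem5p3 (R : realType) (k r : nat -> R) (f : R -> R)
    (H : nat -> R) (xi : R) (x a : nat -> R)
    (k_summable : summable_seq k)
    (r_resolvent : is_resolvent k r)
    (r_summable : summable_seq r)
    (f_continuous : continuous f)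
    (f_pinfty : f t / t @[t --> +oo] --> (1 : R))
    (f_ninfty : f t / t @[t --> -oo] --> (1 : R))
    (x_solution : is_volterra_solution k f H xi x)
    (a_increasing : nondecreasing_seq a)
    (a_infty : a n @[n --> \oo] --> +oo)
    (H_Lambda : (0 <= Lambda a H <= +oo)%E) :
  [/\ (Lambda a x = 0%E <-> Lambda a H = 0%E),
      ((0 < Lambda a x < +oo)%E <-> (0 < Lambda a H < +oo)%E)
    & (Lambda a x = +oo%E <-> Lambda a H = +oo%E)].
Proof.
have f_sub e : 0 < e ->
    exists2 C, 0 <= C & forall t, `|f t - t| <= e * `|t| + C.
  exact: asymp_id_sublinear.
have [A [B [B0 xH]]] := solution_dominated _ _ _ _ _ _
  k_summable r_resolvent r_summable f_sub x_solution.
have [A' [D [D0 Hx]]] := forcing_dominated _ _ _ _ _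
  k_summable (f_sub _ ltr01) x_solution.
apply: (comparable_trichotomy _ _ B D) => //; try exact: Lambda_ge0.
- exact: Lambda_le_dominated a_infty a_increasing B0 xH.
- exact: Lambda_le_dominated a_infty a_increasing D0 Hx.
Qed.
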